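(* Let $r\le 5$ be a positive integer. Every intersecting $r$-partite hypergraph $H$ with $\tau(H)\ge r-1$ and exactly $f(r)$ edges is linear.
   Context: A hypergraph is $r$-partite if its vertex set can be partitioned into $r$ sets (the sides) so that every edge contains exactly one vertex from each side; it is intersecting if every two edges share a vertex; an intersecting hypergraph is linear if every two distinct edges meet in exactly one vertex. The covering number $\tau(H)$ is the minimum size of a set of vertices meeting every edge. $f(r)$ is the smallest integer $k$ for which there exists an intersecting $r$-partite hypergraph with $k$ edges and covering number at least $r-1$. *)

(* Defs.v *)
From mathcomp Require Export all_boot.

Set Implicit Arguments.
Unset Strict Implicit.
Unset Printing Implicit Defensive.

(* A finite hypergraph is a vertex type T : finType together with its edge set
   E : {set {set T}}. *)

(* The indexed partition V_0, ..., V_(r-1) of the vertices is given by the map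
   side : T -> 'I_r sending each vertex to the index of its side. *)
Definition partite (r : nat) (T : finType) (E : {set {set T}}) : Prop :=
  exists side : T -> 'I_r,
    forall e, e \in E -> forall i : 'I_r, #|[set x in e | side x == i]| = 1.

Definition intersecting (T : finType) (E : {set {set T}}) : Prop :=
  forall e e', e \in E -> e' \in E -> e :&: e' != set0.

Definition linear_hypergraph (T : finType) (E : {set {set T}}) : Prop :=
  forall e e', e \in E -> e' \in E -> e != e' -> #|e :&: e'| = 1.

Definition is_cover (T : finType) (E : {set {set T}}) (C : {set T}) : bool :=
  [forall e in E, e :&: C != set0].

(* The vertex set [set: T] covers E as soon as no edge is empty, which holds
   for r-partite E with 0 < r; otherwise E has no cover and the value is
   meaningless. *)
Definition tau (T : finType) (E : {set {set T}}) : nat :=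
  #|[arg min_(C < [set: T] | is_cover E C) #|C|]|.

Definition attained (r k : nat) : Prop :=
  exists (T : finType) (E : {set {set T}}),
    [/\ partite r E, intersecting E, r.-1 <= tau E & #|E| = k].

(* is_f r k means k = f(r).  It is a relation because no k may be attained for
   a general r. *)
Definition is_f (r k : nat) : Prop :=
  attained r k /\ forall k', attained r k' -> k <= k'.

(* Main.v *)
Require Import Defs.
From mathcomp Require Import all_boot zify.

Set Implicit Arguments.
Unset Strict Implicit.
Unset Printing Implicit Defensive.

(* Put k = r - 2.  Explicit examples give f(r) <= 3k for r = 3, 4, 5, and an
   edge set with fewer than 3k edges is padded to 3k edges by repetition, so it
   suffices to treat lists of 3k pairwise meeting edges not covered by k
   vertices.  Any m uncovered edges can be covered by m/2 vertices, hence j <= k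
   vertices leave at least 2(k - j) + 1 edges uncovered.  For r = 4, 5, counting
   the meeting pairs of edges side by side yields a vertex in exactly k + 1
   edges; call them B and the remaining 2k - 1 edges C.  The edges of B meet
   those of C on the other k + 1 sides only, at most |C| times on each, while
   |B||C| = (k + 1)|C| meetings are needed: so every edge of B meets every edge
   of C exactly once.  What remains is a finite problem about C and two edges of
   B.  For r = 5 its size is cut down by observing that C is a near
   1-factorization of K_5, whose edges can be numbered by the side on which they
   are alone. *)

(** * Exhaustive search over canonically labelled families *)

(* [all] with a lazy conjunction: [vm_compute] evaluates both arguments of
   [&&], so [all] would not stop at the first failure. *)
Fixpoint lall (X : Type) (p : pred X) (s : seq X) : bool :=
  if s is x :: s' then if p x then lall p s' else false else true.

Lemma lallE (X : Type) (p : pred X) (s : seq X) : lall p s = all p s.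
Proof. by elim: s => //= x s ->. Qed.

(** [ext] proposes candidates for the next entry, [chk] prunes prefixes, [final] is tested on
    complete lists. Soundness only asks that [ext] and [chk] let through every list that can
    occur. *)
Fixpoint search (X : Type) (ext : seq X -> seq X) (chk final : pred (seq X))
    (m : nat) (xs : seq X) : bool :=
  if m is m'.+1 then
    lall (fun x => if chk (rcons xs x) then search ext chk final m' (rcons xs x)
                   else true) (ext xs)
  else final xs.

Lemma search_cat (X : eqType) (x0 : X) ext (chk final : pred (seq X)) ys xs :
    search ext chk final (size ys) xs ->
    (forall n, n < size ys -> nth x0 ys n \in ext (xs ++ take n ys)) ->
    (forall n, n < size ys -> chk (xs ++ take n.+1 ys)) ->
  final (xs ++ ys).
Proof.
elim: ys xs => [|y ys IH] xs /=; first by rewrite cats0.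
rewrite lallE => /allP search_ys ext_ys chk_ys.
have := search_ys y; rewrite -[xs in y \in ext xs]cats0 (ext_ys 0) //.
have := chk_ys 0 isT; rewrite take0 cats1 => -> /(_ isT) search_y.
rewrite -cat_rcons; apply: IH => // n n_lt.
  by rewrite cat_rcons; apply: (ext_ys n.+1).
by rewrite cat_rcons; apply: (chk_ys n.+1).
Qed.

Lemma searchP (X : eqType) (x0 : X) ext (chk final : pred (seq X)) xs :
    search ext chk final (size xs) [::] ->
    (forall n, n < size xs -> nth x0 xs n \in ext (take n xs)) ->
    (forall n, n < size xs -> chk (take n.+1 xs)) ->
  final xs.
Proof. exact: (@search_cat X x0 ext chk final xs [::]). Qed.

Fixpoint choices (X : Type) (os : seq (seq X)) : seq (seq X) :=
  if os is o :: os' then [seq x :: y | x <- o, y <- choices os'] else [:: [::]].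

Lemma mem_choices (I X : eqType) (f : I -> X) (o : I -> seq X) (s : seq I) :
  {in s, forall i, f i \in o i} -> map f s \in choices (map o s).
Proof.
elim: s => [|i s IH] //= f_o; apply: allpairs_f; first by rewrite f_o ?mem_head.
by apply: IH => j js; rewrite f_o // inE js orbT.
Qed.

Lemma choicesP (X : eqType) (o s : seq X) :
  {subset s <= o} -> s \in choices (nseq (size s) o).
Proof.
move=> so; rewrite -[s in s \in _]map_id.
have -> : nseq (size s) o = map (fun=> o) s by elim: (s) => //= x s' ->.
exact: mem_choices.
Qed.

Fixpoint sublists (X : Type) (m : nat) (s : seq X) : seq (seq X) :=
  if m is m'.+1 then
    if s is x :: s' then [seq x :: y | y <- sublists m' s'] ++ sublists m s'
    else [::]
  else [:: [::]].

Lemma size_sublists (X : eqType) m (s t : seq X) :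
  t \in sublists m s -> size t = m.
Proof.
elim: s m t => [|x s IHs] [|m] t //=; try by rewrite inE => /eqP ->.
rewrite mem_cat => /orP [/mapP [y /IHs y_m ->]|/IHs //] /=.
by rewrite y_m.
Qed.

(** * Columns *)

(* Replacing every entry by the position of its first occurrence makes the
   search space finite without changing the equality pattern. *)
Definition relabel (c : seq nat) : seq nat := [seq index x c | x <- c].

(** A first occurrence is labelled by its own position, so the only fresh label is [size c]. *)
Definition labels (bound : nat -> nat) (c : seq nat) : seq nat :=
  [seq l <- rcons (undup c) (size c) | count_mem l c < bound (size c)].

Lemma index_in_inj (X : eqType) (c : seq X) : {in c &, injective (index^~ c)}.
Proof. by move=> x y xc yc /= e; rewrite -(nth_index x xc) e nth_index. Qed.

Lemma count_mem_map_in (X Y : eqType) (f : X -> Y) (c s : seq X) x :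
    {in c &, injective f} -> {subset s <= c} -> x \in c ->
  count_mem (f x) (map f s) = count_mem x s.
Proof.
move=> f_inj sc xc; rewrite count_map; apply: eq_in_count => y ys /=.
by apply/eqP/eqP => [/f_inj -> //|->//]; apply: sc.
Qed.

Lemma count_take (X : Type) (p : pred X) n s : count p (take n s) <= count p s.
Proof. by rewrite -[s in leqRHS](cat_take_drop n) count_cat leq_addr. Qed.

Lemma count_take_ltn (X : eqType) (x0 : X) (c : seq X) n m :
  n < size c -> n < m ->
  count_mem (nth x0 c n) (take n c) < count_mem (nth x0 c n) (take m c).
Proof.
move=> n_c n_m; apply: leq_trans (count_take _ n.+1 _); rewrite take_takel //.
by rewrite (take_nth x0) // -cats1 count_cat /= eqxx addn0 addn1.
Qed.

Lemma leq_count_in (X : eqType) (p q : pred X) (s : seq X) :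
  {in s, subpred p q} -> count p s <= count q s.
Proof.
move=> pq; rewrite -(eq_in_count (a1 := predI p q)).
  by apply: sub_count => x /andP [].
by move=> x xs /=; case px: (p x) => //=; rewrite (pq x xs px).
Qed.

Lemma relabel_labels bound (c : seq nat) n :
    n < size c ->
    count_mem (nth 0 c n) (take n c) < bound n ->
  nth 0 (relabel c) n \in labels bound (take n (relabel c)).
Proof.
move=> n_c lt_b; set x := nth 0 c n; have xc : x \in c by rewrite mem_nth.
have sub : {subset take n c <= c} by move=> y; apply: mem_take.
rewrite (nth_map 0) // -/x -map_take mem_filter size_map size_takel ?(ltnW n_c) //.
rewrite (count_mem_map_in (@index_in_inj _ c) sub) // lt_b /=.
rewrite mem_rcons inE mem_undup.
have le_n : index x c <= n by rewrite leqNgt; apply/negP => /(before_find 0) /=; rewrite eqxx.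
case: ltngtP le_n => // lt_n _; apply/mapP; exists x => //.
by rewrite -(nth_index 0 xc) -[nth 0 c _](nth_take _ lt_n) mem_nth // size_takel // ltnW.
Qed.

(** The trace that uncoverability leaves on a single side. *)
Definition csparse (m t : nat) (c : seq nat) : Prop :=
  forall s : seq nat, size s = m -> count [in s] c + t <= size c.

(** Vacuous when there are fewer than m labels, hence weaker than [csparse]; a filter in a search
    only has to be implied by it. *)
Definition csparseb (m t : nat) (c : seq nat) : bool :=
  lall (fun s => count [in s] c + t <= size c) (sublists m (undup c)).

Lemma csparse_relabel m t c : csparse m t c -> csparseb m t (relabel c).
Proof.
move=> sp; rewrite /csparseb lallE; apply/allP => s /size_sublists sz_s.
rewrite size_map; apply: leq_trans (sp [seq nth 0 c l | l <- s] _); last by rewrite size_map.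
rewrite leq_add2r count_map; apply: leq_count_in => x xc /= xs.
by apply/mapP; exists (index x c) => //; rewrite nth_index.
Qed.

(** The sum of the squared multiplicities: it counts the ordered pairs of edges, each edge with
    itself included, that agree on the side. *)
Definition col_weight (c : seq nat) : nat := sumn [seq count_mem x c | x <- c].

Lemma col_weight_relabel c : col_weight (relabel c) = col_weight c.
Proof.
rewrite /col_weight /relabel -map_comp; congr sumn; apply/eq_in_map => x xc /=.
by apply: count_mem_map_in (@index_in_inj _ c) _ xc.
Qed.

Definition light_search (N d t k : nat) : bool :=
  search (labels (fun=> d)) xpredT
    (fun c => if csparseb k 1 c then col_weight c < t else true) N [::].

(** If every label occurred at most d times, the search would visit the relabelled column and find
    its weight below t. *)
Lemma heavy_column N d t k (c : seq nat) :
    light_search N d t k -> size c = N -> csparse k 1 c -> t <= col_weight c ->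
  exists2 x, x \in c & d < count_mem x c.
Proof.
move=> srch c_N sp le_t; apply/hasP; apply: contraLR le_t; rewrite -all_predC => /allP few.
rewrite -ltnNge -col_weight_relabel.
have := searchP (x0 := 0) (xs := relabel c) _ _ _.
rewrite size_map c_N => /(_ _ _ _ srch) /=; rewrite csparse_relabel //; apply => // n n_lt.
rewrite relabel_labels ?c_N //.
have := few (nth 0 c n); rewrite mem_nth ?c_N //= -leqNgt => /(_ isT); apply: leq_trans.
by rewrite -c_N in n_lt; have := count_take_ltn 0 n_lt n_lt; rewrite take_size.
Qed.

Lemma light_search4 : light_search 6 2 14 2. Proof. by vm_compute. Qed.
Lemma light_search5 : light_search 9 3 24 3. Proof. by vm_compute. Qed.

Lemma size_undup_map_in (X Y : eqType) (f : X -> Y) (s : seq X) :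
  {in s &, injective f} -> size (undup (map f s)) = size (undup s).
Proof.
move=> f_inj; rewrite -[RHS](size_map f); apply: perm_size; apply: uniq_perm.
- exact: undup_uniq.
- rewrite map_inj_in_uniq ?undup_uniq // => x y.
  by rewrite !mem_undup; apply: f_inj.
- by move=> y; rewrite mem_undup; apply/mapP/mapP => -[x xs ->]; exists x;
    rewrite ?mem_undup // -mem_undup.
Qed.

(* What the search shows about two entries of [B] in a column [C ++ B] with the
   maximal number of coincidences between [C] and [B]. *)
Definition allowed (C : seq nat) (l l' : nat) : bool :=
  if 0 < count_mem l C + count_mem l' C then
    if (l == l') && (count_mem l C == 1) then uniq C else true
  else false.

Lemma allowed_map (f : nat -> nat) (c C : seq nat) l l' :
    {in c &, injective f} -> {subset C <= c} -> l \in c -> l' \in c ->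
  allowed (map f C) (f l) (f l') = allowed C l l'.
Proof.
move=> f_inj Cc lc l'c; rewrite /allowed !(count_mem_map_in f_inj Cc) //.
rewrite (_ : (f l == f l') = (l == l')); last first.
  by apply/eqP/eqP => [/f_inj -> //|->].
by rewrite map_inj_in_uniq // => x y /Cc xc /Cc yc; apply: f_inj.
Qed.

Definition incidences (C B : seq nat) : nat := sumn [seq count_mem l C | l <- B].

(** Later [q] is |C|, and counting shows that all sides but one attain it. What attaining it forces
    is recorded by [allowed], which then prunes the search over two rows of B. *)
Definition split_bound (n q : nat) (c : seq nat) : bool :=
  let C := take n c in let B := drop n c in
  (incidences C B <= q) && ((incidences C B == q) ==> pairwise (allowed C) B).

(** C comes first in the column, so the bound 2 limits multiplicities inside C alone, while [d]
    limits them in the whole column. *)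
Definition split_search (n q N d k : nat) : bool :=
  search (labels (fun m => if m < n then 2 else d))
    (fun c => size (undup (take n c)) <= 3)
    (fun c => if csparseb 2 (2 * (k - 2)).+1 c then
                if csparseb k 1 c then split_bound n q c else true else true)
    N [::].

Lemma split_bound_relabel n q c : split_bound n q (relabel c) = split_bound n q c.
Proof.
have inj := @index_in_inj _ c.
have sT : {subset take n c <= c} by move=> y; apply: mem_take.
have sD : {subset drop n c <= c} by move=> y; apply: mem_drop.
rewrite /split_bound.
have -> : incidences (take n (relabel c)) (drop n (relabel c))
          = incidences (take n c) (drop n c).
  rewrite /incidences -map_drop -map_take -map_comp; congr sumn.
  by apply/eq_in_map => x xB /=; rewrite (count_mem_map_in inj sT) ?sD.
congr (_ && (_ ==> _)); rewrite -map_drop -map_take pairwise_map.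
apply: (eq_in_pairwise (P := [in c])); last exact/allP.
by move=> x y /= xc yc; rewrite (allowed_map inj sT).
Qed.

Lemma column_split n q N d k (c : seq nat) :
    split_search n q N d k -> size c = N -> n <= N ->
    csparse 2 (2 * (k - 2)).+1 c -> csparse k 1 c ->
    (forall x, count_mem x c <= d) -> (forall x, count_mem x (take n c) <= 2) ->
    size (undup (take n c)) <= 3 ->
  split_bound n q c.
Proof.
move=> srch c_N n_N sp2 spk cap_d cap_2 le3; rewrite -split_bound_relabel.
have inj := @index_in_inj _ c.
have := searchP (x0 := 0) (xs := relabel c) _ _ _.
rewrite size_map c_N => /(_ _ _ _ srch) /=; rewrite !csparse_relabel //; apply => m m_N.
  rewrite relabel_labels ?c_N //.
  case: ifP => m_n; last first.
    apply: leq_trans (cap_d (nth 0 c m)).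
    by rewrite -c_N in m_N; have := count_take_ltn 0 m_N m_N; rewrite take_size.
  by apply: leq_trans (cap_2 (nth 0 c m)); rewrite count_take_ltn ?c_N.
rewrite -!map_take size_undup_map_in; last first.
  by move=> x y /mem_take/mem_take xc /mem_take/mem_take yc; apply: inj.
apply: leq_trans le3; apply: uniq_leq_size (undup_uniq _) _ => x.
by rewrite !mem_undup -take_min minnC take_min => /mem_take.
Qed.

Lemma split_search4 : split_search 3 3 6 3 2. Proof. by vm_compute. Qed.
Lemma split_search5 : split_search 5 5 9 4 3. Proof. by vm_compute. Qed.

(** * Families of rows *)

(* An edge of an [r]-partite hypergraph is encoded by the list [a] of its [r]
   vertices, one on each side; the pair [(i, l)] stands for vertex [l] of side
   [i].  Families are lists, so that edges may be repeated. *)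
Definition on (v : nat * nat) (a : seq nat) : bool := nth 0 a v.1 == v.2.
Definition covered (s : seq (nat * nat)) (a : seq nat) : bool := has (on^~ a) s.
Definition agree (a b : seq nat) (i : nat) : bool := nth 0 a i == nth 0 b i.
Definition common (r : nat) (a b : seq nat) : nat := count (agree a b) (iota 0 r).
Definition column (F : seq (seq nat)) (i : nat) : seq nat :=
  [seq nth 0 a i | a <- F].
Definition on_sides (r : nat) : pred (seq (nat * nat)) := all (fun v => v.1 < r).

Definition meeting (r : nat) (F : seq (seq nat)) : Prop :=
  {in F &, forall a b, has (agree a b) (iota 0 r)}.
Definition uncoverable (r k : nat) (F : seq (seq nat)) : Prop :=
  forall s, on_sides r s -> size s = k -> has (predC (covered s)) F.
(** Compares positions rather than values, so for r > 1 it also excludes repeated rows: a row has r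
    vertices in common with itself. *)
Definition linear_rows (r : nat) : pred (seq (seq nat)) :=
  pairwise (fun a b => common r a b == 1).

Lemma agreeC a b i : agree a b i = agree b a i.
Proof. exact: eq_sym. Qed.

Lemma commonC r a b : common r a b = common r b a.
Proof. by apply: eq_count => i; apply: agreeC. Qed.

Lemma common_refl r a : common r a a = r.
Proof.
by rewrite /common (eq_count (a2 := predT)) ?count_predT ?size_iota // => i; apply: eqxx.
Qed.

Lemma count_sum (X : Type) (p : pred X) (s : seq X) :
  count p s = \sum_(x <- s) (p x : nat).
Proof. by elim: s => [|x s IH] /=; rewrite ?big_nil // big_cons IH. Qed.

Lemma count_mem_column F i l : count_mem l (column F i) = count (on (i, l)) F.
Proof. by rewrite count_map; apply: eq_count. Qed.

Lemma size_column F i : size (column F i) = size F.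
Proof. exact: size_map. Qed.

(* Pairing up the uncovered rows and covering each pair by one common vertex. *)
Lemma cover_pairs r F u t :
    0 < r -> meeting r F -> {subset u <= F} -> size u <= t.*2 ->
  exists s, [/\ on_sides r s, size s = t & all (covered s) u].
Proof.
move=> r_gt0 mF; elim: t u => [|t IH] [|a u] uF //=.
- by exists [::].
- exists (nseq t.+1 (0, 0)); split; rewrite ?size_nseq //.
  by rewrite /on_sides all_nseq r_gt0 orbT.
(* The default [a] pairs a last remaining row with itself. *)
- move=> sz; set b := head a u.
  have aF : a \in F by rewrite uF ?mem_head.
  have bF : b \in F by rewrite /b; case: (u) uF => //= c u' uF; rewrite uF // !inE eqxx orbT.
  have /hasP [i] := mF _ _ aF bF; rewrite mem_iota /= add0n => i_r /eqP ab_i.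
  have [||s [s_r s_t s_u]] := IH (behead u).
  - by move=> c /mem_behead cu; rewrite uF // inE cu orbT.
  - by rewrite size_behead; move: sz; rewrite doubleS; case: (size u).
  exists ((i, nth 0 a i) :: s); split => /=; rewrite ?i_r ?s_t //.
  rewrite /on /= eqxx /=; move: ab_i s_u; rewrite /b; case: (u) => //= c u' ab_i s_u.
  apply/andP; split; first by rewrite /covered /= /on /= ab_i eqxx.
  by apply: sub_all s_u => e /= ->; rewrite orbT.
Qed.

(** Otherwise the rows missed by [s] could be covered in pairs by k - |s| further vertices, which
    completes [s] to a cover of size k. *)
Lemma uncoverable_sparse r k F s :
    0 < r -> meeting r F -> uncoverable r k F -> on_sides r s -> size s <= k ->
  count (covered s) F + (2 * (k - size s)).+1 <= size F.
Proof.
move=> r_gt0 mF uF s_r s_k; rewrite -(count_predC (covered s) F) leq_add2l.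
rewrite ltnNge; apply/negP => few.
have [||s' [s'_r s'_k s'_F]] :=
  @cover_pairs r F (filter (predC (covered s)) F) (k - size s) r_gt0 mF.
- by move=> a; rewrite mem_filter => /andP [].
- by rewrite size_filter -mul2n.
have := uF (s ++ s'); rewrite /on_sides all_cat size_cat s'_k subnKC //.
rewrite -/(on_sides r s) -/(on_sides r s') s_r s'_r => /(_ isT erefl) /hasP [a aF /=].
rewrite /covered has_cat negb_or => /andP [a_s].
have /allP/(_ a) := s'_F; rewrite mem_filter /= aF andbT => /(_ a_s).
by rewrite /covered => ->.
Qed.

Lemma column_sparse r k F i m :
    0 < r -> meeting r F -> uncoverable r k F -> i < r -> m <= k ->
  csparse m (2 * (k - m)).+1 (column F i).
Proof.
move=> r_gt0 mF uF i_r m_k s s_m; rewrite size_column count_map.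
have := @uncoverable_sparse r k F [seq (i, l) | l <- s] r_gt0 mF uF.
rewrite size_map s_m /on_sides all_map => /(_ _ m_k).
rewrite (eq_all (a2 := predT)) ?all_predT //.
move=> /(_ isT); apply: leq_trans; rewrite leq_add2r; apply: sub_count => a /= a_s.
by apply/hasP; exists (i, nth 0 a i); [apply: map_f|apply: eqxx].
Qed.

Lemma uncoverable_perm r k F G : perm_eq F G -> uncoverable r k F -> uncoverable r k G.
Proof. by move=> FG uF s s_r s_k; rewrite -(perm_has _ FG); apply: uF. Qed.

Lemma meeting_sub r F G : {subset G <= F} -> meeting r F -> meeting r G.
Proof. by move=> GF mF a b /GF aF /GF bF; apply: mF. Qed.

Lemma col_weight_column F i :
  col_weight (column F i) = \sum_(b <- F) \sum_(a <- F) (agree a b i : nat).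
Proof.
rewrite /col_weight sumnE !big_map; apply: eq_bigr => a _.
by rewrite count_mem_column count_sum.
Qed.

Lemma incidences_column F G i :
  incidences (column F i) (column G i) = \sum_(b <- G) \sum_(a <- F) (agree a b i : nat).
Proof.
rewrite /incidences sumnE !big_map; apply: eq_bigr => b _.
by rewrite count_mem_column count_sum.
Qed.

Lemma sum_common r F G :
  \sum_(i < r) \sum_(b <- G) \sum_(a <- F) (agree a b i : nat)
  = \sum_(b <- G) \sum_(a <- F) common r a b.
Proof.
rewrite exchange_big; apply: eq_bigr => b _; rewrite exchange_big; apply: eq_bigr => a _.
by rewrite /common count_sum -[r in iota 0 r]subn0 -/(index_iota 0 r) big_mkord.
Qed.

(** Double counting of ordered pairs: two rows meet at least once and a row meets itself r times, so
    for N rows the r column weights add up to at least N (N + r - 1). *)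
Lemma exists_heavy_side r F t :
    0 < r -> meeting r F -> r * t < size F * (size F + r.-1) ->
  exists2 i, i < r & t < col_weight (column F i).
Proof.
move=> r_gt0 mF big.
have [/existsP [i lt_t]|/existsPn light] :=
  boolP [exists i : 'I_r, t < col_weight (column F i)]; first by exists i.
suff : size F * (size F + r.-1) <= r * t by rewrite leqNgt big.
have -> : r * t = \sum_(i < r) t by rewrite sum_nat_const card_ord.
apply: (@leq_trans (\sum_(i < r) col_weight (column F i))); last first.
  by apply: leq_sum => i _; rewrite leqNgt light.
under eq_bigr => i _ do rewrite col_weight_column.
rewrite sum_common -sum1_size big_distrl /=.
rewrite big_seq [leqRHS]big_seq; apply: leq_sum => b bF; rewrite mul1n.
apply: (@leq_trans (\sum_(a <- F) (1 + (a == b) * r.-1))).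
  rewrite big_split /= leq_add2l -big_distrl /= -count_sum leq_pmull //.
  by rewrite -has_count; apply/hasP; exists b => /=.
rewrite big_seq [leqRHS]big_seq; apply: leq_sum => a aF.
have := mF _ _ aF bF; rewrite has_count -/(common r a b).
by case: eqP => [->|_]; rewrite ?common_refl ?mul1n ?add1n ?prednK ?mul0n.
Qed.

(** * Relabelled families and row-by-row search *)

Definition relabel_row (r : nat) (F : seq (seq nat)) (a : seq nat) : seq nat :=
  [seq index (nth 0 a i) (column F i) | i <- iota 0 r].
Definition relabel_rows (r : nat) (F : seq (seq nat)) : seq (seq nat) :=
  map (relabel_row r F) F.

Lemma nth_relabel_row r F a i :
  i < r -> nth 0 (relabel_row r F a) i = index (nth 0 a i) (column F i).
Proof. by move=> i_r; rewrite (nth_map 0) ?size_iota // nth_iota. Qed.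

Lemma mem_column (F : seq (seq nat)) a i : a \in F -> nth 0 a i \in column F i.
Proof. exact: map_f. Qed.

Lemma relabel_row_agree r F :
  {in F &, forall a b i, i < r ->
    agree (relabel_row r F a) (relabel_row r F b) i = agree a b i}.
Proof.
move=> a b aF bF i i_r; rewrite /agree !nth_relabel_row //.
by apply/eqP/eqP => [|->//]; apply: index_in_inj; apply: mem_column.
Qed.

Lemma relabel_row_common r F :
  {in F &, forall a b, common r (relabel_row r F a) (relabel_row r F b) = common r a b}.
Proof.
move=> a b aF bF; apply: eq_in_count => i; rewrite mem_iota /= => i_r.
by rewrite relabel_row_agree.
Qed.

Lemma relabel_row_meet r F :
  {in F &, forall a b, has (agree (relabel_row r F a) (relabel_row r F b)) (iota 0 r)
     = has (agree a b) (iota 0 r)}.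
Proof. by move=> a b aF bF; rewrite !has_count -!/(common _ _ _) relabel_row_common. Qed.

Lemma column_relabel_rows r F i :
  i < r -> column (relabel_rows r F) i = relabel (column F i).
Proof.
move=> i_r; rewrite /column /relabel -!map_comp.
by apply: eq_map => a /=; rewrite nth_relabel_row.
Qed.

Lemma linear_relabel_rows r F : linear_rows r (relabel_rows r F) = linear_rows r F.
Proof.
rewrite /linear_rows pairwise_map; apply: (eq_in_pairwise (P := [in F])); last exact/allP.
by move=> a b aF bF /=; rewrite relabel_row_common.
Qed.

Definition extensions (r : nat) (lab : nat -> seq nat -> seq nat) (F : seq (seq nat)) :=
  choices [seq lab i (column F i) | i <- iota 0 r].

Lemma row_searchP r lab chk final F :
    search (extensions r lab) chk final (size F) [::] ->
    (forall n i, n < size F -> i < r ->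
      nth 0 (relabel (column F i)) n \in lab i (take n (relabel (column F i)))) ->
    (forall n, n < size F -> chk (map (relabel_row r F) (take n.+1 F))) ->
  final (relabel_rows r F).
Proof.
move=> srch lab_F chk_F.
have := searchP (x0 := [::]) (xs := relabel_rows r F) _ _ _.
rewrite size_map => /(_ _ _ _ srch); apply => n n_F; last first.
  by rewrite -map_take; apply: chk_F.
rewrite (nth_map [::]) //; apply: mem_choices => i; rewrite mem_iota /= => i_r.
have := lab_F n i n_F i_r.
rewrite /column map_take -/(column (relabel_rows r F) i) column_relabel_rows //.
by rewrite /column (nth_map 0) ?size_map // (nth_map [::]).
Qed.

(** Earlier pairs were tested on the shorter prefixes, so only the last row needs a test. *)
Definition meets_last (r : nat) (F : seq (seq nat)) : bool :=
  let a := last [::] F in lall (fun b => has (agree a b) (iota 0 r)) F.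

Lemma last_map_take (F : seq (seq nat)) (f : seq nat -> seq nat) n :
  n < size F -> last [::] (map f (take n.+1 F)) = f (nth [::] F n).
Proof.
by move=> n_F; rewrite (take_nth [::]) // map_rcons last_rcons.
Qed.

Lemma meets_last_relabel r F n :
  meeting r F -> n < size F -> meets_last r (map (relabel_row r F) (take n.+1 F)).
Proof.
move=> mF n_F; rewrite /meets_last lallE last_map_take // all_map.
apply/allP => b /mem_take bF /=.
by rewrite relabel_row_meet ?mem_nth //; apply: mF => //; apply: mem_nth.
Qed.

(** * The finite searches over families *)

Definition triangle_search : bool :=
  search (extensions 3 (fun=> labels (fun=> 2))) (meets_last 3) (linear_rows 3) 3 [::].

Lemma triangle_searchT : triangle_search. Proof. by vm_compute. Qed.

Lemma relabel_label F bound i n :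
    n < size F ->
    count_mem (nth 0 (column F i) n) (take n.+1 (column F i)) <= bound n ->
  nth 0 (relabel (column F i)) n \in labels bound (take n (relabel (column F i))).
Proof.
move=> n_F; rewrite -(size_column F i) in n_F => le_b; apply: relabel_labels => //.
exact: leq_trans (count_take_ltn 0 n_F (ltnSn n)) le_b.
Qed.

(** A vertex on all three rows would be a cover of size 1. Hence at most one pair agrees on each of
    the three sides, which leaves exactly one meeting for each of the three pairs. *)
Lemma three_rows_linear F :
  size F = 3 -> meeting 3 F -> uncoverable 3 1 F -> linear_rows 3 F.
Proof.
move=> F3 mF uF; rewrite -linear_relabel_rows.
apply: (row_searchP (lab := fun=> labels (fun=> 2)) (chk := meets_last 3))
  => [|n i n_F i_r|n n_F]; first by rewrite F3; apply: triangle_searchT.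
  2: exact: meets_last_relabel.
apply: relabel_label => //; apply: leq_trans (count_take _ _ _) _.
rewrite count_mem_column.
have := @uncoverable_sparse 3 1 F [:: (i, nth 0 (column F i) n)] isT mF uF.
rewrite /on_sides /= i_r F3 => /(_ isT isT).
rewrite (eq_count (a2 := on (i, nth 0 (column F i) n))); first by lia.
by move=> a; rewrite /covered /= orbF.
Qed.

(** For i < g, row i is alone on side i among the first n rows; the bound is 1 because row i counts
    itself. The [minn] lets the test run on prefixes. *)
Definition diagonal (g n : nat) (F : seq (seq nat)) : bool :=
  lall (fun i => count (fun b => agree (nth [::] F i) b i) (take n F) <= 1)
    (iota 0 (minn g (size F))).

Lemma diagonal_map r g n F (f : seq nat -> seq nat) :
    g <= r ->
    {in F &, forall a b i, i < r -> agree (f a) (f b) i = agree a b i} ->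
  diagonal g n (map f F) = diagonal g n F.
Proof.
move=> g_r f_F; rewrite /diagonal !lallE size_map; apply: eq_in_all => i.
rewrite mem_iota leq_min /= => /andP [i_g i_F]; congr (_ <= 1).
rewrite -map_take count_map; apply: eq_in_count => b /mem_take bF /=.
by rewrite (nth_map [::]) // f_F ?mem_nth // (leq_trans i_g).
Qed.

Lemma diagonal_take g n m F : diagonal g n F -> diagonal g n (take m F).
Proof.
rewrite /diagonal !lallE => /allP diag; apply/allP => i.
rewrite mem_iota add0n size_take_min !leq_min /= => /and3P [i_g i_m i_F].
have := diag i; rewrite mem_iota add0n leq_min i_g i_F => /(_ isT).
apply: leq_trans; rewrite nth_take //.
by rewrite -take_min minnC take_min count_take.
Qed.

Lemma diagonal_cat g F G :
  g <= size F -> diagonal g (size F) F -> diagonal g (size F) (F ++ G).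
Proof.
move=> g_F; rewrite /diagonal !lallE size_cat (minn_idPl g_F) (minn_idPl _); last first.
  by rewrite (leq_trans g_F) ?leq_addr.
move=> /allP diag; apply/allP => i i_g; have := diag i i_g.
move: i_g; rewrite mem_iota /= => i_g.
by rewrite nth_cat (leq_trans i_g) // take_size_cat // take_size.
Qed.

Definition diagonalizable (F : seq (seq nat)) : bool :=
  all (fun i => size (undup (column F i)) <= 3) (iota 0 5) &&
  has (fun p => diagonal 5 5 [seq nth [::] F x | x <- p]) (permutations (iota 0 5)).

Definition diagonal_search : bool :=
  search (extensions 5 (fun=> labels (fun=> 2))) (meets_last 5) diagonalizable
    5 [::].

Lemma diagonal_searchT : diagonal_search. Proof. by vm_compute. Qed.

(* Five pairwise meeting rows without a vertex on three of them form a near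
   1-factorization of K5: on each side exactly one row is alone, and different
   rows are alone on different sides. *)
Lemma five_rows_diagonal C :
    size C = 5 -> meeting 5 C ->
    (forall i x, i < 5 -> count_mem x (column C i) <= 2) ->
  exists C', [/\ perm_eq C' C, diagonal 5 5 C' &
    forall i, i < 5 -> size (undup (column C' i)) <= 3].
Proof.
move=> C5 mC cap.
have /andP [/allP few /hasP [p]] : diagonalizable (relabel_rows 5 C).
  apply: (row_searchP (lab := fun=> labels (fun=> 2)) (chk := meets_last 5))
    => [|n i n_C i_r|n n_C]; first by rewrite C5; apply: diagonal_searchT.
    by apply: relabel_label => //; apply: leq_trans (count_take _ _ _) _; apply: cap.
  exact: meets_last_relabel.
rewrite mem_permutations => p_perm diag.
have pC : {in p, forall x, x < size C}.
  by move=> x; rewrite (perm_mem p_perm) mem_iota C5.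
have C'_perm : perm_eq [seq nth [::] C x | x <- p] C.
  by rewrite -[C in perm_eq _ C](mkseq_nth [::]) /mkseq C5 perm_map.
exists [seq nth [::] C x | x <- p]; split => //.
  (* The permutation was found for the relabelled rows; these have the same agreements, so it serves
     [C] itself. *)
  move: diag.
  rewrite (_ : map _ p = map (relabel_row 5 C) [seq nth [::] C x | x <- p]); last first.
    by rewrite -map_comp; apply/eq_in_map => x /pC x_C /=; rewrite (nth_map [::]).
  rewrite (diagonal_map (r := 5)) // => a b.
  by rewrite !(perm_mem C'_perm) => aC bC i; apply: relabel_row_agree.
move=> i i_5; have := few i; rewrite mem_iota => /(_ i_5).
rewrite column_relabel_rows // size_undup_map_in; last exact: index_in_inj.
apply: leq_trans; rewrite leq_eqVlt; apply/orP; left; apply/eqP; apply: perm_size.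
by apply: perm_undup; apply: perm_mem; apply: perm_map.
Qed.

(** On side i0 the rows of B share a vertex that is on no row of C; it first occurs at position n,
    so its label is n. *)
Definition block_labels (n i0 d i : nat) (c : seq nat) : seq nat :=
  if (i == i0) && (n <= size c) then [:: n]
  else labels (fun m => if m < n then 2 else d) c.

(** The first n rows are C; then come two rows of B, first [b] and last [a]. Each must meet every
    row of C exactly once, and [allowed] is tested when both are present. Nested conditionals keep
    the evaluation lazy. *)
Definition pair_check (r n i0 g : nat) (F : seq (seq nat)) : bool :=
  if meets_last r F then
    if diagonal g n F then
      if size F <= n then true else
      let a := last [::] F in
      if lall (fun c => common r a c == 1) (take n F) then
        if size F <= n.+1 then true else
        let b := nth [::] F n in
        lall (fun i => if i == i0 then true else
          allowed (column (take n F) i) (nth 0 b i) (nth 0 a i)) (iota 0 r)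
      else false
    else false
  else false.

Definition pair_search (r n d g i0 : nat) : bool :=
  search (extensions r (block_labels n i0 d)) (pair_check r n i0 g)
    (linear_rows r) n.+2 [::].

Lemma pair_linear r n d g i0 C a b :
    pair_search r n d g i0 -> size C = n -> g <= n -> g <= r ->
    meeting r (C ++ [:: a; b]) ->
    (forall i x, i < r -> count_mem x (column C i) <= 2) ->
    (forall i x, i < r -> count_mem x (column (C ++ [:: a; b]) i) <= d) ->
    agree a b i0 -> nth 0 a i0 \notin column C i0 ->
    diagonal g n C ->
    {in C, forall c, common r c a = 1} -> {in C, forall c, common r c b = 1} ->
    (forall i, i < r -> i != i0 -> allowed (column C i) (nth 0 a i) (nth 0 b i)) ->
  linear_rows r (C ++ [:: a; b]).
Proof.
set F := C ++ _ => srch C_n g_n g_r mF cap2 capd ab a_C diag exact_a exact_b allow.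
have F_n : size F = n.+2 by rewrite size_cat C_n addn2.
have CF c : c \in C -> c \in F by rewrite mem_cat => ->.
have aF : a \in F by rewrite mem_cat !inE eqxx orbT.
have bF : b \in F by rewrite mem_cat !inE eqxx !orbT.
have takeF : take n F = C by rewrite take_size_cat.
have F_a : nth [::] F n = a by rewrite nth_cat C_n ltnn subnn.
have F_b : nth [::] F n.+1 = b by rewrite nth_cat C_n ltnNge leqnSn /= subSnn.
have colF i : column F i = column C i ++ [:: nth 0 a i; nth 0 b i].
  by rewrite /column map_cat.
rewrite -linear_relabel_rows.
apply: (row_searchP (lab := block_labels n i0 d) (chk := pair_check r n i0 g)) => [|m i|m].
- by rewrite F_n.
- rewrite F_n => m_n i_r.
  rewrite /block_labels size_take_min !size_map F_n (minn_idPl (ltnW m_n)).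
  case: ifP => [/andP [/eqP -> n_m]|_].
    rewrite inE (nth_map 0) ?size_column ?F_n // colF nth_cat size_column C_n.
    rewrite ltnNge n_m /= index_cat.
    have -> : nth 0 [:: nth 0 a i0; nth 0 b i0] (m - n) = nth 0 a i0.
      have : m - n < 2 by lia.
      by case: (m - n) => [|[|]] //= _; rewrite (eqP ab).
    by rewrite (negbTE a_C) /= eqxx addn0 size_column C_n.
  apply: relabel_label; rewrite ?F_n //.
  case: ifP => m_lt; last by apply: leq_trans (count_take _ _ _) _; apply: capd.
  apply: leq_trans (cap2 i (nth 0 (column F i) m) i_r).
  by rewrite colF takel_cat ?count_take // size_column C_n.
rewrite F_n => m_n; have m_F : m < size F by rewrite F_n.
rewrite /pair_check meets_last_relabel //.
rewrite (diagonal_map (r := r)) //; last first.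
  by move=> x y /mem_take xF /mem_take yF; apply: relabel_row_agree.
rewrite diagonal_take; last by rewrite /F -C_n diagonal_cat ?C_n.
rewrite size_map size_takel // last_map_take // -map_take.
case: leqP => // n_m; rewrite (take_takel F (leqW n_m)) takeF.
rewrite lallE all_map; have /orP m_eq : (m == n) || (m == n.+1) by lia.
have -> : all (preim (relabel_row r F)
    (fun c => common r (relabel_row r F (nth [::] F m)) c == 1)) C.
  apply/allP => c cC /=; rewrite relabel_row_common ?mem_nth ?CF // commonC.
  by case: m_eq => /eqP ->; rewrite ?F_a ?F_b ?exact_a ?exact_b.
case: m_eq => /eqP m_eq; rewrite m_eq ?leqnn // ltnn F_b.
rewrite lallE; apply/allP => i; rewrite mem_iota /= => i_r; case: eqP => // /eqP i_i0.
rewrite (nth_map [::]) ?size_takel ?F_n // nth_take // F_a !nth_relabel_row //.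
rewrite (_ : column (map _ C) i = map (index^~ (column F i)) (column C i)); last first.
  by rewrite /column -!map_comp; apply: eq_map => c /=; rewrite nth_relabel_row.
rewrite (allowed_map (@index_in_inj _ (column F i))) ?mem_column //; first exact: allow.
by move=> x; rewrite colF mem_cat => ->.
Qed.

Lemma pair_search4 : all (pair_search 4 3 3 0) (iota 0 4). Proof. by vm_compute. Qed.
Lemma pair_search5 : all (pair_search 5 5 4 5) (iota 0 5). Proof. by vm_compute. Qed.

(** * Splitting the family at a heavy vertex *)

Lemma sum_seq_min (X : eqType) (f : X -> nat) (s : seq X) m :
    {in s, forall x, m <= f x} -> \sum_(x <- s) f x <= size s * m ->
  {in s, forall x, f x = m}.
Proof.
move=> f_min sum_le x xs; apply/eqP; rewrite eqn_leq f_min // andbT leqNgt.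
apply: contraL sum_le => x_gt; rewrite -ltnNge.
rewrite (perm_big _ (perm_to_rem xs)) big_cons /= (perm_size (perm_to_rem xs)) /= mulSn.
rewrite -addSn leq_add // -sum1_size big_distrl /= big_seq [leqRHS]big_seq.
by apply: leq_sum => y /mem_rem ys; rewrite mul1n f_min.
Qed.

(** The count of meetings between C and B is tight in two ways: each pair meets exactly once, and
    each side other than i0 carries exactly n meetings, which makes [allowed] available. The search
    over C and two rows of B then applies to every pair from B. *)
Lemma split_linear k n g i0 C B :
    1 < k -> n = (2 * (k - 1)).+1 -> size C = n -> size B = k.+1 -> i0 < k.+2 ->
    g <= n -> g <= k.+2 ->
    split_search n n (3 * k) k.+1 k -> pair_search k.+2 n k.+1 g i0 ->
    meeting k.+2 (C ++ B) -> uncoverable k.+2 k (C ++ B) ->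
    {in B &, forall a b, agree a b i0} ->
    {in C & B, forall c b, ~~ agree c b i0} ->
    (forall i x, i < k.+2 -> count_mem x (column C i) <= 2) ->
    (forall i, i < k.+2 -> size (undup (column C i)) <= 3) ->
    diagonal g n C ->
  linear_rows k.+2 (C ++ B).
Proof.
move=> k_gt1 n_k C_n B_k i0_r g_n g_r srch_s srch_p mF uF B_i0 C_B cap2 few diag.
have F_k : size (C ++ B) = 3 * k by rewrite size_cat C_n B_k; lia.
have capd i x : i < k.+2 -> count_mem x (column (C ++ B) i) <= k.+1.
  move=> i_r; have := column_sparse (m := 1) (ltn0Sn _) mF uF i_r (ltnW k_gt1).
  move=> /(_ [:: x] erefl); rewrite size_column F_k.
  by rewrite (eq_count (a2 := pred1 x)) => [|y] /=; rewrite ?inE //; lia.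
have colF i : column (C ++ B) i = column C i ++ column B i by rewrite /column map_cat.
have split_i i : i < k.+2 ->
    (incidences (column C i) (column B i) <= n) &&
    ((incidences (column C i) (column B i) == n) ==>
       pairwise (allowed (column C i)) (column B i)).
  move=> i_r; have C_i : size (column C i) = n by rewrite size_column.
  have := @column_split n n (3 * k) k.+1 k (column (C ++ B) i) srch_s.
  rewrite /split_bound colF take_size_cat // drop_size_cat // -colF size_column F_k.
  apply => //; rewrite ?few //; try lia.
  - exact: (column_sparse (ltn0Sn _) mF uF i_r k_gt1).
  - by have := column_sparse (ltn0Sn _) mF uF i_r (leqnn k); rewrite subnn.
  - by move=> x; apply: capd.
  - by move=> x; apply: cap2.
have mCB : {in C & B, forall c b, 0 < common k.+2 c b}.
  by move=> c b cC bB; rewrite -has_count mF // mem_cat ?cC // bB orbT.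
have inc_i0 : incidences (column C i0) (column B i0) = 0.
  rewrite incidences_column big_seq big1 // => b bB.
  by rewrite big_seq big1 // => c cC; rewrite (negbTE (C_B _ _ cC bB)).
(* C and B never meet on side i0, where B passes through a vertex missed by C. *)
pose bnd (i : 'I_k.+2) := if val i == i0 then 0 else n.
have le_bnd (i : 'I_k.+2) : incidences (column C i) (column B i) <= bnd i.
  rewrite /bnd; case: eqP => [->|_]; first by rewrite inc_i0.
  by have /andP [] := split_i i (ltn_ord i).
have sum_bnd : \sum_i bnd i = k.+1 * n.
  rewrite (bigD1 (Ordinal i0_r)) //= /bnd eqxx add0n.
  rewrite (eq_bigr (fun=> n)) => [|i]; last by rewrite -val_eqE /= => /negbTE ->.
  by rewrite sum_nat_const cardC1 card_ord.
have sum_inc : \sum_(i < k.+2) incidences (column C i) (column B i)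
    = \sum_(b <- B) \sum_(c <- C) common k.+2 c b.
  by rewrite -sum_common; apply: eq_bigr => i _; apply: incidences_column.
have inner b : b \in B -> n <= \sum_(c <- C) common k.+2 c b.
  move=> bB; rewrite -C_n -sum1_size big_seq [leqRHS]big_seq.
  by apply: leq_sum => c cC; apply: mCB.
have sum_le : \sum_(b <- B) \sum_(c <- C) common k.+2 c b <= size B * n.
  by rewrite -sum_inc B_k -sum_bnd; apply: leq_sum.
have inner_eq := sum_seq_min inner sum_le.
have exactCB : {in C & B, forall c b, common k.+2 c b = 1}.
  move=> c b cC bB; apply: (sum_seq_min (f := common k.+2 ^~ b) (s := C)) => //.
    by move=> c' c'C; apply: mCB.
  by rewrite inner_eq // muln1 C_n.
(* The total number of meetings equals the sum of the bounds, so each bound is attained. *)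
have inc_eq (i : 'I_k.+2) : val i != i0 -> incidences (column C i) (column B i) = n.
  move=> i_i0; have := leqif_sum (fun i (_ : true) => leqif_eq (le_bnd i)).
  rewrite sum_inc sum_bnd; case=> _.
  rewrite big_seq (eq_bigr (fun=> n)) => [|b bB]; last exact: inner_eq.
  rewrite -big_seq big_const_seq count_predT iter_addn_0 B_k mulnC eqxx.
  move=> /esym/forallP/(_ i) /=.
  by rewrite /bnd (negbTE i_i0) => /eqP.
have pairs : pairwise (fun a b => linear_rows k.+2 (C ++ [:: a; b])) B.
  apply/(pairwiseP [::]) => x y /= x_B y_B x_y.
  have {}x_B : x < size B := x_B.
  have {}y_B : y < size B := y_B.
  set a := nth _ _ x; set b := nth _ _ y.
  have aB : a \in B by rewrite mem_nth.
  have bB : b \in B by rewrite mem_nth.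
  have subF : {subset C ++ [:: a; b] <= C ++ B}.
    by move=> c; rewrite !mem_cat !inE => /or3P [->|/eqP ->|/eqP ->] //; rewrite ?aB ?bB orbT.
  apply: (pair_linear srch_p) => //.
  - exact: meeting_sub subF mF.
  (* As x < y, [[:: a; b]] is a subsequence of [B], so multiplicities can only drop. *)
  - move=> i z i_r; apply: leq_trans (capd i z i_r).
    rewrite !count_mem_column !count_cat leq_add2l; apply: leq_count_subseq.
    apply: subseq_trans (drop_subseq B x); rewrite (drop_nth [::]) // -/a.
    rewrite /= eqxx sub1seq.
    by rewrite /b -(subnKC x_y) -nth_drop mem_nth // size_drop ltn_sub2r // (leq_ltn_trans x_y).
  - by apply: B_i0.
  - by apply/mapP => -[c cC /eqP]; apply/negP; rewrite eq_sym; apply: C_B.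
  - by move=> c cC; apply: exactCB.
  - by move=> c cC; apply: exactCB.
  move=> i i_r i_i0; have /andP [_] := split_i i i_r.
  have /= -> := inc_eq (Ordinal i_r) i_i0; rewrite eqxx /= => /(pairwiseP 0).
  move=> /(_ x y); rewrite !inE size_column => /(_ x_B y_B x_y).
  by rewrite !(nth_map [::]).
rewrite /linear_rows pairwise_cat; apply/and3P; split.
- by apply/allrelP => c b cC bB; rewrite exactCB.
(* Any pair from B yields the linearity of C; the first two rows exist because B has k + 1 rows. *)
- have : linear_rows k.+2 (C ++ [:: nth [::] B 0; nth [::] B 1]).
    by move/(pairwiseP [::]): pairs; apply => //; rewrite inE B_k //; lia.
  by rewrite /linear_rows pairwise_cat => /and3P [].
- apply: sub_pairwise pairs => a b; rewrite /linear_rows pairwise_cat => /and3P [_ _].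
  by rewrite pairwise2.
Qed.

Lemma count_predU_filter (X : Type) (p q : pred X) (s : seq X) :
  count (predU p q) s = count p s + count q (filter (predC p) s).
Proof. by elim: s => //= x s ->; case: (p x) => /=; lia. Qed.

(** The threshold [w] separates two facts: some column has weight above w on average grounds, while
    multiplicities up to k allow at most w. So some vertex lies on more than k rows. *)
Lemma heavy_linear k N n w g F :
    1 < k -> N = 3 * k -> n = (2 * (k - 1)).+1 -> g <= n -> g <= k.+2 ->
    light_search N k w.+1 k -> k.+2 * w < N * (N + k.+1) ->
    split_search n n N k.+1 k ->
    all (pair_search k.+2 n k.+1 g) (iota 0 k.+2) ->
    (forall C, size C = n -> meeting k.+2 C ->
       (forall i x, i < k.+2 -> count_mem x (column C i) <= 2) ->
       exists C', [/\ perm_eq C' C, diagonal g n C' &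
         forall i, i < k.+2 -> size (undup (column C' i)) <= 3]) ->
    size F = N -> meeting k.+2 F -> uncoverable k.+2 k F ->
  exists2 G, perm_eq G F & linear_rows k.+2 G.
Proof.
move=> k_gt1 -> n_k g_n g_r srch_l w_lt srch_s /allP srch_p reorder F_k mF uF.
have [i0 i0_r w_i0] : exists2 i, i < k.+2 & w < col_weight (column F i).
  by apply: exists_heavy_side; rewrite ?F_k.
have [||l _ l_gt] := heavy_column srch_l _ _ w_i0; first by rewrite size_column.
  by have := column_sparse (ltn0Sn _) mF uF i0_r (leqnn k); rewrite subnn.
rewrite count_mem_column in l_gt; set v := (i0, l) in l_gt.
(* One vertex leaves at least 2(k - 1) + 1 = n of the 3k rows, so v lies on at most k + 1 of them,
   hence on exactly k + 1. *)
have size_le : count (on v) F + n <= 3 * k.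
  have := @uncoverable_sparse k.+2 k F [:: v] isT mF uF.
  rewrite /on_sides /= i0_r -n_k F_k => /(_ isT (ltnW k_gt1)).
  by rewrite (eq_count (a2 := on v)) => [|a] /=; rewrite /covered /= ?orbF.
pose B := filter (on v) F; pose C := filter (predC (on v)) F.
have FE := count_predC (on v) F; rewrite F_k in FE.
have B_k : size B = k.+1 by rewrite size_filter; lia.
have C_n : size C = n by rewrite size_filter; lia.
have CF : {subset C <= F} by move=> a; rewrite mem_filter => /andP [].
(* Two vertices leave at least 2(k - 2) + 1 rows, so besides v a vertex covers at most 3k - (k + 1)
   - (2k - 3) = 2 rows of C. *)
have cap2 i x : i < k.+2 -> count_mem x (column C i) <= 2.
  move=> i_r; rewrite count_mem_column.
  have := @uncoverable_sparse k.+2 k F [:: v; (i, x)] isT mF uF.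
  rewrite /on_sides /= i0_r i_r F_k => /(_ isT k_gt1).
  have -> : count (covered [:: v; (i, x)]) F = size B + count (on (i, x)) C.
    rewrite size_filter -count_predU_filter; apply: eq_count => a.
    by rewrite /covered /= orbF.
  by rewrite B_k; move: (count _ C) k_gt1 => m; clear; lia.
have [C' [C'_perm diag few]] := reorder C C_n (meeting_sub CF mF) cap2.
have F'_perm : perm_eq (C' ++ B) F.
  by rewrite perm_sym -(perm_filterC (on v) F) perm_sym perm_catC perm_cat2l.
exists (C' ++ B) => //; apply: (split_linear (n := n) (g := g) (i0 := i0)) => //.
- by rewrite (perm_size C'_perm).
- by apply: srch_p; rewrite mem_iota.
- by apply: meeting_sub mF => a; rewrite (perm_mem F'_perm).
- by apply: uncoverable_perm uF; rewrite perm_sym.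
- move=> a b; rewrite !mem_filter => /andP [/eqP /= av _] /andP [/eqP /= bv _].
  by rewrite /agree av bv.
- move=> c b; rewrite (perm_mem C'_perm) !mem_filter => /andP [cv _] /andP [/eqP /= bv _].
  by rewrite /agree bv.
- move=> i x i_r; have /permP -> : perm_eq (column C' i) (column C i) by apply: perm_map.
  exact: cap2.
Qed.

Lemma uncoverable_linear r k N F :
    (r, k, N) \in [:: (3, 1, 3); (4, 2, 6); (5, 3, 9)] ->
    size F = N -> meeting r F -> uncoverable r k F ->
  {in F &, forall a b, a != b -> common r a b = 1}.
Proof.
move=> rkN F_N mF uF.
have [r_gt1 [G GF linG]] : 1 < r /\ exists2 G, perm_eq G F & linear_rows r G.
  move: rkN F_N mF uF; rewrite !inE => /or3P [] /eqP [-> -> ->] F_N mF uF; split => //.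
  - by exists F => //; apply: three_rows_linear.
  (* 13 is the largest w with 4w < 6 * 9; g = 0 asks for no diagonal. *)
  - apply: (@heavy_linear 2 6 3 13 0 F isT erefl erefl isT isT
      light_search4 isT split_search4 pair_search4 _ F_N mF uF) => C C3 _ _.
    exists C; split => // [|i _]; first by rewrite /diagonal min0n.
    by rewrite (leq_trans (size_undup _)) // size_column C3.
  (* 23 is the largest w with 5w < 9 * 13, and is the weight of the multiplicities 3, 3, 2, 1. *)
  - exact: (@heavy_linear 3 9 5 23 5 F isT erefl erefl isT isT
      light_search5 isT split_search5 pair_search5 five_rows_diagonal F_N mF uF).
have uG : uniq G.
  apply: pairwise_uniq linG => a /=; rewrite common_refl; lia.
move=> a b; rewrite -!(perm_mem GF) => aG bG.
have lin x y : x < y -> y < size G -> common r (nth [::] G x) (nth [::] G y) = 1.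
  move=> x_y y_G; apply/eqP; move/(pairwiseP [::]): linG; apply => //.
  by rewrite inE; apply: ltn_trans y_G.
rewrite -(nth_index [::] aG) -(nth_index [::] bG) nth_uniq ?index_mem //.
case: ltngtP => // [lt_ab|lt_ba] _; first by rewrite lin ?index_mem.
by rewrite commonC lin ?index_mem.
Qed.

(** * Hypergraphs as families of rows *)

Lemma intersecting_cover (T : finType) (E : {set {set T}}) :
  intersecting E -> is_cover E [set: T].
Proof. by move=> iE; apply/forall_inP => e eE; rewrite setIT -[e]setIid iE. Qed.

Lemma tau_leq (T : finType) (E : {set {set T}}) (C : {set T}) :
  intersecting E -> is_cover E C -> tau E <= #|C|.
Proof.
move=> /intersecting_cover coverT; rewrite /tau.
by case: arg_minnP => // D _ D_min /D_min.
Qed.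

Section Rows.
Variables (r : nat) (T : finType) (E : {set {set T}}) (side : T -> 'I_r).
Hypothesis sideE :
  forall e, e \in E -> forall i : 'I_r, #|[set x in e | side x == i]| = 1.

(** [pickle] is injective, so equal entries mean equal vertices. An edge of E has a vertex on every
    side, so the default 0 is never taken for it. *)
Definition row (e : {set T}) : seq nat :=
  mkseq (fun i => if [pick v in e | side v == i :> nat] is Some v then pickle v else 0) r.

Lemma row_nth e v : e \in E -> v \in e -> nth 0 (row e) (side v) = pickle v.
Proof.
move=> eE ve; rewrite nth_mkseq //; case: pickP => [u /andP [ue /eqP uv]|/(_ v)]; last first.
  by rewrite ve eqxx.
have /eqP/cards1P [w /setP wE] := sideE eE (side v).
have := wE v; rewrite !inE ve eqxx /= => /esym/eqP ->.
by have := wE u; rewrite !inE ue -val_eqE /= uv eqxx /= => /esym/eqP ->.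
Qed.

Lemma row_vertex e (i : 'I_r) : e \in E -> exists2 v, v \in e & side v = i.
Proof.
move=> eE; have /eqP/cards1P [v /setP/(_ v)] := sideE eE i.
by rewrite !inE eqxx => /andP [ve /eqP]; exists v.
Qed.

Lemma row_on e (i : 'I_r) l :
  e \in E -> nth 0 (row e) i = l -> exists2 v, v \in e & l = pickle v /\ side v = i.
Proof.
move=> eE; have [v ve <-] := row_vertex i eE.
by rewrite row_nth // => <-; exists v.
Qed.

Lemma row_agree e e' v : e \in E -> e' \in E -> v \in e ->
  agree (row e) (row e') (side v) = (v \in e').
Proof.
move=> eE e'E ve; rewrite /agree (row_nth eE) //; apply/eqP/idP => [/esym|ve'].
  by move=> /(row_on e'E) [u ue' [/(pcan_inj pickleK) -> _]].
by rewrite row_nth.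
Qed.

(** Sorted by sides, the intersection gets one vertex from each side where the rows agree and none
    from the others. *)
Lemma row_common e e' : e \in E -> e' \in E -> common r (row e) (row e') = #|e :&: e'|.
Proof.
move=> eE e'E; rewrite -sum1_card (partition_big side predT) //=.
rewrite /common count_sum -[r in iota 0 r]subn0 -/(index_iota 0 r) big_mkord.
apply: eq_bigr => i _; have [v ve v_i] := row_vertex i eE.
rewrite -v_i row_agree // sum1dep_card.
have /eqP/cards1P [w /setP wE] := sideE eE i.
have := wE v; rewrite !inE ve v_i eqxx /= => /esym/eqP vw.
have -> : [set x | (x \in e :&: e') && (side x == i)] = [set x in [set v] | x \in e'].
  apply/setP => x; have := wE x; rewrite -vw !inE => <-.
  by rewrite andbAC.
case: (boolP (v \in e')) => ve'.
  by rewrite (_ : [set x in _ | _] = [set v]) ?cards1 //; apply/setP => x;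
    rewrite !inE; case: eqP => // ->.
by apply/esym/eqP; rewrite cards_eq0; apply/eqP/setP => x; rewrite !inE;
  case: eqP => // ->; rewrite (negbTE ve').
Qed.

Lemma row_inj : {in E &, injective row}.
Proof.
move=> e e' eE e'E row_eq; apply/setP => v; apply/idP/idP => [ve|ve'].
  by rewrite -(row_agree eE e'E ve) row_eq /agree.
by rewrite -(row_agree e'E eE ve') row_eq /agree.
Qed.

Lemma row_meeting s : intersecting E -> {subset s <= E} -> meeting r (map row s).
Proof.
move=> iE sE a b /mapP [e /sE eE ->] /mapP [e' /sE e'E ->].
by rewrite has_count -/(common _ _ _) row_common // card_gt0 iE.
Qed.

Lemma row_uncoverable s : intersecting E -> r.-1 <= tau E -> 1 < r -> s =i E ->
  uncoverable r r.-2 (map row s).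
Proof.
move=> iE tauE r_gt1 sE l l_r l_k.
(* Decoding forgets the sides and drops numbers that code no vertex, so at most r - 2 vertices
   result. *)
pose C := [set v in pmap (fun p => unpickle p.2 : option T) l].
have C_small : #|C| < tau E.
  apply: leq_trans tauE; rewrite -ltnS in r_gt1.
  rewrite cardsE; apply: leq_ltn_trans (card_size _) _.
  rewrite size_pmap; apply: leq_ltn_trans (count_size _ _) _; rewrite l_k; lia.
have : ~~ is_cover E C by apply: contraL C_small => /(tau_leq iE); rewrite -leqNgt.
rewrite negb_forall_in => /exists_inP [e eE]; rewrite negbK => /eqP e_C.
rewrite has_map; apply/hasP; exists e; rewrite ?sE //=.
apply/hasP => -[[i x] il /= /eqP /= nth_x].
have i_r : i < r by apply: (allP l_r _ il).
have [v ve [x_v _]] := row_on (i := Ordinal i_r) eE nth_x.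
have /setP/(_ v) := e_C; rewrite !inE ve /= mem_pmap => /mapP; case.
by exists (i, x) => //=; rewrite x_v pickleK.
Qed.

End Rows.

Lemma few_edges_linear r N (T : finType) (E : {set {set T}}) :
    (r, r.-2, N) \in [:: (3, 1, 3); (4, 2, 6); (5, 3, 9)] ->
    partite r E -> intersecting E -> r.-1 <= tau E -> #|E| <= N ->
  linear_hypergraph E.
Proof.
move=> rN [side sideE] iE tauE E_N e e' eE e'E e_e'.
have r_gt1 : 1 < r by move: rN; rewrite !inE => /or3P [] /eqP [-> _ _].
(* Padding with copies of [e] keeps the rows meeting and uncoverable. *)
pose s := enum E ++ nseq (N - #|E|) e.
have sE : s =i E.
  by move=> x; rewrite mem_cat mem_enum mem_nseq; case: eqP => [->|]; rewrite ?eE ?andbF ?orbF.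
have s_N : size (map (row side) s) = N.
  by rewrite size_map size_cat size_nseq -cardE subnKC.
have mS : meeting r (map (row side) s) by apply: (row_meeting sideE) => // x; rewrite sE.
have uS := row_uncoverable sideE iE tauE r_gt1 sE.
rewrite -(row_common sideE) //; apply: (uncoverable_linear rN s_N mS uS); rewrite ?map_f ?sE //.
by apply: contra e_e' => /eqP/(row_inj sideE eE e'E) ->.
Qed.

(** * Extremal examples *)

Definition vertices (r M : nat) : seq (nat * nat) :=
  [seq (i, l) | i <- iota 0 r, l <- iota 0 M].

(** Tuples of r - 2 vertices may repeat a vertex, so smaller covers are excluded too; [M] bounds the
    labels. *)
Definition example (r M : nat) (F : seq (seq nat)) : bool :=
  [&& all (fun a => (size a == r) && all (gtn M) a) F, uniq F,
    all (fun a => all (fun b => has (agree a b) (iota 0 r)) F) F &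
    all (fun s => has (predC (covered s)) F) (choices (nseq r.-2 (vertices r M)))].

Lemma example_attained r M F : 0 < r -> 0 < M -> example r M F -> attained r (size F).
Proof.
move=> r_gt0 M_gt0 /and4P [/allP F_rM F_uniq /allP mF /allP uF].
have ltM a i : a \in F -> i < r -> nth 0 a i < M.
  move=> /F_rM /andP [/eqP a_r /allP a_M] i_r; apply: (a_M (nth 0 a i)).
  by rewrite mem_nth ?a_r.
pose edge a := [set v : 'I_r * 'I_M | nth 0 a v.1 == v.2 :> nat].
pose E := [set e in map edge F].
have edge_vertex a i (i_r : i < r) (aF : a \in F) :
  (Ordinal i_r, Ordinal (ltM a i aF i_r)) \in edge a by rewrite inE.
have iE : intersecting E.
  move=> e e'; rewrite !inE => /mapP [a aF ->] /mapP [b bF ->].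
  have /allP/(_ b bF)/hasP [i] := mF a aF; rewrite mem_iota /= => i_r /eqP ab.
  apply/set0Pn; exists (Ordinal i_r, Ordinal (ltM a i aF i_r)).
  by rewrite inE edge_vertex inE /= ab.
exists ('I_r * 'I_M)%type, E; split => //.
- exists fst => e; rewrite inE => /mapP [a aF ->] i.
  rewrite (_ : [set x in _ | _] = [set (i, Ordinal (ltM a i aF (ltn_ord i)))]) ?cards1 //.
  apply/setP => -[j l]; rewrite !inE /= xpair_eqE -(val_eqE l) /= andbC eq_sym.
  by case: eqP => // ->; rewrite eq_sym.
- rewrite /tau; case: arg_minnP => [|C coverC _]; first exact: intersecting_cover.
  rewrite leqNgt; apply/negP => C_small.
  (* A cover with fewer than r - 1 vertices is padded to r - 2 entries by the vertex (0, 0). *)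
  pose s := [seq (val v.1, val v.2) | v <- enum C] ++ nseq (r.-2 - #|C|) (0, 0).
  have s_r : size s = r.-2.
    rewrite size_cat size_map -cardE size_nseq subnKC //.
    by rewrite -ltnS (leq_trans C_small) // leqSpred.
  have := uF s; rewrite -s_r choicesP => [/(_ isT)|].
    move=> /hasP [a aF /=]; apply/negP; rewrite negbK.
    have /forall_inP/(_ (edge a)) := coverC; rewrite inE map_f // => /(_ isT).
    case/set0Pn => v; rewrite !inE => /andP [/eqP va vC].
    apply/hasP; exists (val v.1, val v.2); last by rewrite /on /= va.
    by rewrite mem_cat map_f ?mem_enum.
  move=> [i l]; rewrite mem_cat mem_nseq => /orP [/mapP [v _ [-> ->]]|/andP [_ /eqP [-> ->]]].
    by apply: allpairs_f; rewrite mem_iota /= ltn_ord.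
  by apply: allpairs_f; rewrite mem_iota.
- rewrite cardsE; have /card_uniqP -> : uniq (map edge F); last by rewrite size_map.
  rewrite map_inj_in_uniq // => a b aF bF /setP ab.
  have /andP [/eqP a_r _] := F_rM a aF; have /andP [/eqP b_r _] := F_rM b bF.
  apply: (@eq_from_nth _ 0) => [|i]; rewrite a_r ?b_r // => i_r.
  by have := ab (Ordinal i_r, Ordinal (ltM a i aF i_r)); rewrite !inE /= eqxx => /esym/eqP.
Qed.

Lemma attained_small r : 0 < r -> r <= 2 -> attained r 1.
Proof.
case: r => [|[|[|r]]] // _ _.
  exact: (@example_attained 1 1 [:: [:: 0]]).
exact: (@example_attained 2 1 [:: [:: 0; 0]]).
Qed.

Lemma attained3 : attained 3 3.
Proof.
have ex : example 3 3 [:: [:: 0; 0; 0]; [:: 0; 1; 1]; [:: 1; 0; 1]] by vm_compute.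
exact: (example_attained (ltn0Sn _) (ltn0Sn _) ex).
Qed.

(** The first three rows are the edges C, the last three the edges B through vertex 3 of side 0. *)
Lemma attained4 : attained 4 6.
Proof.
have ex : example 4 6 [:: [:: 0; 0; 0; 0]; [:: 0; 1; 1; 1]; [:: 2; 0; 1; 2];
  [:: 3; 0; 3; 1]; [:: 3; 1; 0; 2]; [:: 3; 5; 1; 0]] by vm_compute.
exact: (example_attained (ltn0Sn _) (ltn0Sn _) ex).
Qed.

(** Here B consists of the last four rows, through vertex 5 of side 0. *)
Lemma attained5 : attained 5 9.
Proof.
have ex : example 5 6 [:: [:: 0; 0; 0; 0; 0]; [:: 1; 1; 0; 1; 1]; [:: 2; 2; 2; 0; 1];
  [:: 1; 2; 3; 3; 0]; [:: 2; 0; 3; 1; 4]; [:: 5; 0; 5; 3; 1]; [:: 5; 1; 3; 0; 5];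
  [:: 5; 2; 0; 5; 4]; [:: 5; 5; 2; 1; 0]] by vm_compute.
exact: (example_attained (ltn0Sn _) (ltn0Sn _) ex).
Qed.

Theorem theorem11 (r : nat) (r_gt0 : 0 < r) (r_le5 : r <= 5)
    (k : nat) (f_r : is_f r k)
    (T : finType) (E : {set {set T}})
    (E_partite : partite r E) (E_intersecting : intersecting E)
    (E_tau : r.-1 <= tau E) (E_card : #|E| = k) :
  linear_hypergraph E.
Proof.
case: f_r => _ k_min; rewrite -E_card in k_min.
have [r_le2|r_gt2] := leqP r 2.
  (* A single edge is an example for r <= 2, so f(r) <= 1 and E has no two distinct edges. *)
  move=> e e' eE e'E; have /card_le1_eqP E1 := k_min _ (attained_small r_gt0 r_le2).
  by rewrite (E1 e e') ?eqxx.
case: r => [|[|[|[|[|[|r]]]]]] // in r_gt0 r_le5 E_partite E_tau k_min r_gt2 *.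
- by apply: (@few_edges_linear 3 3) => //; apply: k_min attained3.
- by apply: (@few_edges_linear 4 6) => //; apply: k_min attained4.
- by apply: (@few_edges_linear 5 9) => //; apply: k_min attained5.
Qed.
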